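(* Let $p$ be a prime and $\beta\ge1$. For $1\le i\le r$ let $A_i$ be a nonzero finite commutative $p$-group, let $A=\bigoplus_{i=1}^r A_i$, and let $B$ be a commutative group of exponent $p^\beta$. Then $$\delta(A,B)=\max_{\underline\beta}\sum_{i=1}^r \delta\big(A_i,\mathbb{Z}/p^{\beta_i+1}\mathbb{Z}\big),$$ where the maximum ranges over all $\underline\beta=(\beta_1,\dots,\beta_r)\in\mathbb N^r$ with $\beta_1+\dots+\beta_r=\beta-1$.
   Context: For commutative groups $A,B$, $B^A$ denotes the commutative group (under pointwise addition) of all maps $A\to B$. For $a\in A$, the difference operator $\Delta_a:B^A\to B^A$ is $(\Delta_a f)(x)=f(x+a)-f(x)$. Let $\widetilde{\mathbb N}=\mathbb N\cup\{-\infty,\infty\}$ ($\mathbb N=\{0,1,2,\dots\}$), totally ordered with $-\infty$ least and $\infty$ greatest. The functional degree $\operatorname{fdeg}(f)\in\widetilde{\mathbb N}$ of $f\in B^A$ is: $-\infty$ if $f=0$; otherwise the least $n\in\mathbb N$ such that $\Delta_{a_1}\cdots\Delta_{a_{n+1}}f=0$ for all $a_1,\dots,a_{n+1}\in A$; and $\infty$ if no such $n$ exists. Define $\delta(A,B)=\sup\{\operatorname{fdeg}(f): f\in B^A\}$. *)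

(* Defs.v *)
From HB Require Import structures.
From mathcomp Require Import all_boot all_order all_algebra.
From Stdlib Require Import ClassicalEpsilon.
Set Implicit Arguments. Unset Strict Implicit. Unset Printing Implicit Defensive.
Import Order.TTheory GRing.Theory Num.Theory.
Local Open Scope ring_scope.

Inductive ntilde := NInf | Fin of nat | PInf.

Definition nt_le (x y : ntilde) : Prop :=
  match x, y with
  | NInf, _ => True
  | _, PInf => True
  | Fin m, Fin n => (m <= n)%N
  | _, _ => False
  end.

Definition nt_add (x y : ntilde) : ntilde :=
  match x, y with
  | NInf, _ | _, NInf => NInf
  | PInf, _ | _, PInf => PInf
  | Fin m, Fin n => Fin (m + n)
  end.

Definition pdec (P : Prop) : bool :=
  if excluded_middle_informative P then true else false.

(* the least natural number satisfying P (meaningful when one exists) *)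
Definition least_nat (P : nat -> Prop) : nat :=
  epsilon (inhabits 0%N) (fun n => P n /\ forall m, P m -> (n <= m)%N).

Definition nt_sup (S : ntilde -> Prop) : ntilde :=
  if pdec (forall x, S x -> x = NInf) then NInf
  else if pdec (exists n, forall x, S x -> nt_le x (Fin n))
  then Fin (least_nat (fun n => forall x, S x -> nt_le x (Fin n)))
  else PInf.

Section FDeg.
Variables (A B : zmodType).

Definition Delta (a : A) (f : A -> B) : A -> B := fun x => f (x + a) - f x.

Definition Deltas (s : seq A) (f : A -> B) : A -> B := foldr Delta f s.

Definition fdeg_le (f : A -> B) (n : nat) : Prop :=
  forall s : seq A, size s = n.+1 -> forall x, Deltas s f x = 0.

Definition fdeg (f : A -> B) : ntilde :=
  if pdec (forall x, f x = 0) then NInf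
  else if pdec (exists n, fdeg_le f n) then Fin (least_nat (fdeg_le f))
  else PInf.

Definition delta : ntilde := nt_sup (fun d => exists f : A -> B, d = fdeg f).
End FDeg.

Section DSum.
Variables (r : nat) (G : 'I_r -> zmodType).
Definition dsum := {dffun forall i, G i}.
HB.instance Definition _ := Choice.on dsum.
Definition dsum_zero : dsum := [ffun i => 0].
Definition dsum_add (f g : dsum) : dsum := [ffun i => f i + g i].
Definition dsum_opp (f : dsum) : dsum := [ffun i => - f i].
Lemma dsum_addA : associative dsum_add.
Proof. by move=> f g h; apply/ffunP => i; rewrite !ffunE addrA. Qed.
Lemma dsum_addC : commutative dsum_add.
Proof. by move=> f g; apply/ffunP => i; rewrite !ffunE addrC. Qed.
Lemma dsum_add0 : left_id dsum_zero dsum_add.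
Proof. by move=> f; apply/ffunP => i; rewrite !ffunE add0r. Qed.
Lemma dsum_addN : left_inverse dsum_zero dsum_opp dsum_add.
Proof. by move=> f; apply/ffunP => i; rewrite !ffunE addNr. Qed.
HB.instance Definition _ :=
  GRing.isZmodule.Build dsum dsum_addA dsum_addC dsum_add0 dsum_addN.
End DSum.

Definition nt_sum (r : nat) (F : 'I_r -> ntilde) : ntilde :=
  foldr (fun i acc => nt_add (F i) acc) (Fin 0) (enum 'I_r).

(* Main.v *)
(** Let I be the augmentation ideal of Z[A]. Since Z[A] acts on B^A through
    translations and B has exponent p^beta, delta(A, B) is the largest m such that
    I^m is not contained in p^beta Z[A]. For A the direct sum of the A_i, Z[A] is
    the tensor product of the Z[A_i] and I^m is the sum of the products of the
    I_i^{m_i} over m_1 + ... + m_r = m. The coefficients of an elementary tensor are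
    products of coefficients of its factors, so the p-adic valuations add up: I^m is
    not contained in p^beta Z[A] iff for some decompositions m = sum m_i and
    beta - 1 = sum beta_i no I_i^{m_i} is contained in p^{beta_i + 1} Z[A_i]. *)
Require Import Defs.
From HB Require Import structures.
From mathcomp Require Import all_boot all_order all_algebra.
From Stdlib Require Import ClassicalEpsilon.
Set Implicit Arguments. Unset Strict Implicit. Unset Printing Implicit Defensive.
Import Order.TTheory GRing.Theory Num.Theory.
Local Open Scope ring_scope.

(** * Suprema and sums in [ntilde], described by the natural numbers below them *)

Lemma pdecP (P : Prop) : reflect P (pdec P).
Proof. by rewrite /pdec; case: excluded_middle_informative => H; constructor. Qed.

Lemma least_natP (P : nat -> Prop) (n : nat) :
  P n -> P (least_nat P) /\ forall m, P m -> (least_nat P <= m)%N.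
Proof.
move=> Pn; apply: (epsilon_spec (inhabits 0%N)
  (fun n => P n /\ forall m, P m -> (n <= m)%N)).
have exP : exists n, pdec (P n) by exists n; apply/pdecP.
exists (ex_minn exP); case: ex_minnP => m /pdecP Pm minm.
by split=> // k Pk; apply/minm/pdecP.
Qed.

(** Reduces the theorem to an equivalence for each natural m: -oo has no natural number below it, n
    has those up to n, and oo has all of them. *)
Lemma nt_eq_of_ge (x y : ntilde) :
  (forall m, nt_le (Fin m) x <-> nt_le (Fin m) y) -> x = y.
Proof.
case: x y => [|n|] [|k|] //= H.
- by case: (H 0%N) => _ /(_ isT).
- by case: (H 0%N) => _ /(_ I).
- by case: (H 0%N) => /(_ isT).
- congr Fin; apply/eqP; rewrite eqn_leq; apply/andP; split.
    by apply/(proj1 (H n)).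
  by apply/(proj2 (H k)).
- by case: (H n.+1) => _ /(_ I); rewrite ltnn.
- by case: (H 0%N) => /(_ I).
- by case: (H k.+1) => /(_ I); rewrite ltnn.
Qed.

Lemma nt_ge_sup (S : ntilde -> Prop) (m : nat) :
  nt_le (Fin m) (nt_sup S) <-> exists x, S x /\ nt_le (Fin m) x.
Proof.
rewrite /nt_sup; case: pdecP => [allN|notN].
  by split=> [//|[x [/allN ->]]].
case: pdecP => [[n0 bnd]|unb].
  have [lub least] := @least_natP (fun n => forall x, S x -> nt_le x (Fin n)) _ bnd.
  split=> [le_m|[x [Sx]]]; last first.
    by have := lub x Sx; case: x {Sx} => //= k le1 le2; apply: leq_trans le2 le1.
  (* If no member of S reaches m, then m - 1 is a smaller bound; for m = 0 all members would be -oo,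
     against [notN]. *)
  apply: NNPP => noS; case: m le_m noS => [|m] le_m noS.
    by apply: notN => -[|k|] Sx //; case: noS; [exists (Fin k) | exists PInf].
  move: le_m; rewrite /= ltnNge => /negP; apply; apply: least => -[|k|] Sx //=.
    by rewrite leqNgt; apply/negP => ?; case: noS; exists (Fin k).
  by case: noS; exists PInf.
split=> // _; apply: NNPP => noS; apply: unb; exists m => -[|k|] Sx //=.
  by rewrite leqNgt; apply/negP => /ltnW ?; case: noS; exists (Fin k).
by case: noS; exists PInf.
Qed.

Lemma nt_ge_add (x y : ntilde) (m : nat) :
  nt_le (Fin m) (nt_add x y) <->
  exists k l, [/\ (k + l)%N = m, nt_le (Fin k) x & nt_le (Fin l) y].
Proof.
split.
  case: x y => [|n|] [|n'|] //= H.
  - exists (minn n m), (m - minn n m)%N; split; first by rewrite subnKC ?geq_minr.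
      exact: geq_minl.
    by rewrite leq_subLR; case: (leqP n m) => // _; apply: leq_addr.
  - by exists 0%N, m.
  - by exists m, 0%N; rewrite addn0.
  - by exists m, 0%N; rewrite addn0.
case=> k [l [<-]]; case: x => [|n|] //; case: y => [|n'|] //=.
exact: leq_add.
Qed.

Lemma nt_ge_sum (r : nat) (F : 'I_r -> ntilde) (m : nat) :
  nt_le (Fin m) (nt_sum F) <->
  exists ms : 'I_r -> nat,
    (\sum_i ms i)%N = m /\ forall i, nt_le (Fin (ms i)) (F i).
Proof.
have -> : (exists ms : 'I_r -> nat,
    (\sum_i ms i)%N = m /\ forall i, nt_le (Fin (ms i)) (F i)) <->
  exists ms : 'I_r -> nat, (\sum_(i <- enum 'I_r) ms i)%N = m /\
    {in enum 'I_r, forall i, nt_le (Fin (ms i)) (F i)}.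
  split=> -[ms [<- H]]; exists ms; split; rewrite ?big_enum //.
  by move=> i; apply: H; rewrite mem_enum.
rewrite /nt_sum; move: (enum_uniq 'I_r); elim: (enum 'I_r) m => [|i s IHs] m /=.
  move=> _; split=> [|[ms []]]; last by rewrite big_nil => <-.
  by rewrite leqn0 => /eqP->; exists (fun=> 0%N); rewrite big_nil.
case/andP=> i_s uniq_s; apply: (iff_trans (nt_ge_add _ _ _)); split.
  case=> k [l [<- le_k /(IHs _ uniq_s) [ms [<- le_ms]]]].
  have neq j : j \in s -> (j == i) = false.
    by move=> js; apply: contraNF i_s => /eqP<-.
  exists (fun j => if j == i then k else ms j); split.
    rewrite big_cons eqxx; congr addn; apply: eq_big_seq => j js.
    by rewrite neq.
  move=> j; rewrite inE => /predU1P[->|js]; rewrite ?eqxx ?neq //; exact: le_ms.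
case=> ms [<- le_ms]; exists (ms i), (\sum_(j <- s) ms j)%N.
split; first by rewrite big_cons.
  by apply: le_ms; rewrite mem_head.
by apply/(IHs _ uniq_s); exists ms; split=> // j js; apply: le_ms; rewrite inE js orbT.
Qed.

(** * Iterated differences and functional degree *)

Section Difference.
Variables A B : zmodType.
Implicit Types (a b x : A) (s : seq A) (f g : A -> B).

Lemma DeltaC a b f : Delta a (Delta b f) =1 Delta b (Delta a f).
Proof.
by move=> x; rewrite /Delta (addrAC x b a) !opprD !opprK [LHS]addrACA.
Qed.

Lemma Deltas_Delta a s f : Deltas s (Delta a f) =1 Delta a (Deltas s f).
Proof.
elim: s => //= b s IHs x; rewrite [LHS]/Delta !IHs -/(Delta b _ x).
exact: DeltaC.
Qed.

Lemma Deltas_eq0 s f : (forall x, f x = 0) -> forall x, Deltas s f x = 0.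
Proof. by move=> f0; elim: s => //= a s IHs x; rewrite /Delta !IHs subrr. Qed.

Lemma fdeg_leW f m n : (m <= n)%N -> fdeg_le f m -> fdeg_le f n.
Proof.
(* The last m + 1 entries of s are applied first and already annihilate f. *)
move=> le_mn H s size_s x; rewrite -(cat_take_drop (n - m) s) /Deltas foldr_cat.
apply: Deltas_eq0 => y; apply: H; rewrite size_drop size_s.
by rewrite subSn ?leq_subr // subKn.
Qed.

(** For m = n + 1 the right side negates [fdeg_le f n]; for m = 0 the list is empty and it says that
    f is nonzero, in line with fdeg(0) = -oo. *)
Lemma nt_ge_fdeg f m :
  nt_le (Fin m) (fdeg f) <-> exists s x, size s = m /\ Deltas s f x <> 0.
Proof.
rewrite /fdeg; case: pdecP => [f0|nf0].
  by split=> [//|[s [x [_]]]]; rewrite Deltas_eq0.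
have nle n : ~ fdeg_le f n -> exists s x, size s = n.+1 /\ Deltas s f x <> 0.
  move=> H; apply: NNPP => H'; apply: H => s sz x; apply: NNPP => D.
  by apply: H'; exists s, x.
have case0 : exists s x, size s = 0%N /\ Deltas s f x <> 0.
  by apply: NNPP => H; apply: nf0 => x; apply: NNPP => fx; apply: H; exists [::], x.
case: pdecP => [[n0 le0]|noN].
  have [lef least] := least_natP le0; split.
    case: m => // m; rewrite /= ltnNge => /negP lt.
    by apply: nle => /least.
  case=> s [x [<- D]] /=; rewrite leqNgt; apply/negP => lt; apply: D.
  apply: (@fdeg_leW f _ (size s).-1 _ lef); last by case: (s) lt.
  by case: (size s) lt.
split=> // _; case: m => // m; apply: nle => le; apply: noN; by exists m.
Qed.

End Difference.

(** * From differences of functions to coefficients in Z[A] *)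

Definition kron (A : zmodType) (x : A) : int := (x == 0)%:R.

(** [kron] is the unit [0] of Z[A], so f is its own convolution with [kron], and differences can be
    moved onto that kernel. *)
Lemma Deltas_conv (A : finZmodType) (B : zmodType) (s : seq A) (f : A -> B) x :
  Deltas s f x = \sum_a f (x - a) *~ Deltas s (@kron A) a.
Proof.
elim: s x => [|b s IHs] x /=.
  rewrite (bigD1 0) //= /kron eqxx subr0 big1 ?addr0 // => a /negPf->.
  by rewrite mulr0z.
rewrite /Delta !IHs (reindex (+%R^~ b)) /=; last first.
  by exists (+%R^~ (- b)) => a _; rewrite ?addrK ?subrK.
rewrite -sumrB; apply: eq_bigr => a _.
by rewrite mulrzBr opprD addrACA subrr addr0.
Qed.

Lemma Deltas_mulrz (A B : zmodType) (s : seq A) (b : B) (g : A -> int) x :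
  Deltas s (fun y => b *~ g y) x = b *~ Deltas s g x.
Proof. by elim: s x => //= a s IHs x; rewrite /Delta !IHs mulrzBr. Qed.

(** The element b has order exactly p^beta. By Bezout, gcd(p^beta, k) = p^j also annihilates b,
    which forces j = beta. *)
Lemma mulrz_eq0_dvdz (B : zmodType) (p beta : nat) (b : B) (k : int) :
  prime p -> b *+ (p ^ beta) = 0 -> b *+ (p ^ beta.-1) != 0 ->
  b *~ k = 0 -> ((p ^ beta)%N %| k)%Z.
Proof.
move=> p_pr bk0 nz bz0; have bn0 : b *+ `|k|%N = 0.
  by case: k bz0 => n //=; rewrite NegzE mulrNz => /eqP; rewrite oppr_eq0 => /eqP.
rewrite dvdzE absz_nat; set n := `|k|%N in bn0 *.
have [j le_j gcdE] : exists2 j : nat, (j <= beta)%N & gcdn (p ^ beta) n = (p ^ j)%N.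
  by apply/(dvdn_pfactor _ _ p_pr); apply: dvdn_gcdl.
have pb_gt0 : (0 < p ^ beta)%N by rewrite expn_gt0 prime_gt0.
have bj0 : b *+ (p ^ j) = 0.
  have [u _ /dvdnP[q def_q]] := Bezoutl n pb_gt0.
  have := congr1 (GRing.natmul b) def_q.
  rewrite mulrnDr gcdE !(mulnC _ n) !(mulnC _ (p ^ beta)%N) !mulrnA.
  by rewrite bn0 bk0 !mul0rn addr0.
apply/gcdn_idPl; rewrite gcdE; congr expn; apply/eqP.
rewrite eqn_leq le_j /= leqNgt; apply: contraNN nz => lt_j.
have le_j' : (j <= beta.-1)%N by case: (beta) lt_j.
by rewrite -(subnKC le_j') expnD mulrnA bj0 mul0rn.
Qed.

(* With I the augmentation ideal of Z[A], this says that the power I^m is not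
   contained in d Z[A]: the values of [Deltas s kron] are, up to a -> -a, the
   coefficients of the product of the [a] - [0] over a in s. *)
Definition aug_pow_nondvd (A : zmodType) (d : int) (m : nat) : Prop :=
  exists s x, size s = m /\ ~~ (d %| Deltas s (@kron A) x)%Z.

(** If p^beta divides all coefficients, the convolution formula annihilates every f. Conversely b
    times [kron], with b of order p^beta, detects any coefficient that p^beta does not divide. *)
Lemma nt_ge_delta (A : finZmodType) (B : zmodType) (p beta m : nat) :
  prime p -> (forall b : B, b *+ (p ^ beta) = 0) ->
  (exists b : B, b *+ (p ^ beta.-1) != 0) ->
  nt_le (Fin m) (delta A B) <-> aug_pow_nondvd A (p ^ beta)%N m.
Proof.
move=> p_pr expB [b nz_b]; rewrite /delta nt_ge_sup; split.
  case=> _ [[f ->]] /nt_ge_fdeg[s [x [sz D]]]; exists s.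
  apply: NNPP => dvd; apply: D; rewrite Deltas_conv big1 // => a _.
  have /dvdzP[q ->] : ((p ^ beta)%N %| Deltas s (@kron A) a)%Z.
    by apply/negPn/negP => nd; apply: dvd; exists a.
  by rewrite mulrC mulrzA -pmulrn expB mul0rz.
case=> s [x [sz nd]]; exists (fdeg (fun y : A => b *~ kron y)).
split; first by exists (fun y : A => b *~ kron y).
apply/nt_ge_fdeg; exists s, x; split=> //; rewrite Deltas_mulrz => D.
by rewrite (mulrz_eq0_dvdz p_pr (expB b) nz_b D) in nd.
Qed.

Lemma nt_ge_delta_Zp (A : finZmodType) (p b m : nat) : prime p ->
  nt_le (Fin m) (delta A 'Z_(p ^ b.+1)) <-> aug_pow_nondvd A (p ^ b.+1)%N m.
Proof.
(* ['Z_n] is Z/n only for n > 1, which the exponent b + 1 guarantees. *)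
move=> p_pr; have q_gt1 : (1 < p ^ b.+1)%N by rewrite -(exp1n b.+1) ltn_exp2r ?prime_gt1.
apply: nt_ge_delta => // [x|]; first by rewrite -mulr_natr pchar_Zp ?mulr0.
exists 1; apply/eqP => /(congr1 val) /=; rewrite val_Zp_nat //= modn_small.
  by move/eqP; rewrite expn_eq0 -leqn0 leqNgt prime_gt0.
by rewrite ltn_exp2l ?prime_gt1.
Qed.

(** * Additivity of the p-adic valuation on products *)

Lemma pfactor_ndvdn_prod (r p beta : nat) (c : 'I_r -> nat) :
  prime p -> (0 < r)%N -> (1 <= beta)%N ->
  ~~ (p ^ beta %| \prod_i c i)%N <->
  exists bs : 'I_r -> nat, (\sum_i bs i)%N = beta.-1 /\
    forall i, ~~ (p ^ (bs i).+1 %| c i)%N.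
Proof.
case: r c => // r c p_pr _ beta_gt0.
have lognP : (forall i, 0 < c i)%N ->
    logn p (\prod_i c i) = (\sum_i logn p (c i))%N.
  move=> c_gt0; suff [] : logn p (\prod_i c i) = (\sum_i logn p (c i))%N /\
    (0 < \prod_i c i)%N by [].
  elim/big_rec2: _ => [|i v w _ [<- w_gt0]]; first by rewrite logn1.
  by rewrite lognM // muln_gt0 c_gt0.
split=> [nd|[bs [sum_bs nd]]].
  have c_gt0 i : (0 < c i)%N.
    rewrite lt0n; apply: contraNneq nd => ci0.
    by rewrite (bigD1 i) //= ci0 mul0n dvdn0.
  move: nd; rewrite pfactor_dvdn ?prodn_gt0 // lognP // -ltnNge => lt_v.
  pose v i := logn p (c i).
  (* Each beta_i must be at least the valuation of c i; the slack up to beta - 1 is given to index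
     0, which exists as the family is nonempty. *)
  exists (fun i => v i + (if i == ord0 then beta.-1 - \sum_j v j else 0))%N.
  split; last by move=> i; rewrite pfactor_dvdn // -ltnNge ltnS leq_addr.
  rewrite big_split /= [X in (_ + X)%N](bigD1 ord0) //=.
  rewrite [X in (_ + (_ + X))%N]big1 => [|i /negPf-> //].
  by rewrite addn0 subnKC // -ltnS prednK.
have c_gt0 i : (0 < c i)%N.
  by rewrite lt0n; apply: contraNneq (nd i) => ->; rewrite dvdn0.
rewrite pfactor_dvdn ?prodn_gt0 // lognP // -ltnNge -(prednK beta_gt0) ltnS -sum_bs.
by apply: leq_sum => i _; have := nd i; rewrite pfactor_dvdn // -ltnNge ltnS.
Qed.

(** Makes the direct sum a finite group, so that [nt_ge_delta], whose proof sums over the group,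
    applies to it. *)
HB.instance Definition _ (r : nat) (A : 'I_r -> finZmodType) :=
  Finite.copy (dsum (fun i => (A i : zmodType))) {dffun forall i, A i}.

(** * Powers of the augmentation ideal of a direct sum *)

Section DirectSum.
Variables (r : nat) (G : 'I_r -> zmodType).

Definition dsum_in (i : 'I_r) (a : G i) : dsum G :=
  [ffun j => dfwith (fun j => 0 : G j) a j].

Lemma dsum_inE (x : dsum G) : x = \sum_i dsum_in (x i).
Proof.
suff H j (s : seq 'I_r) : uniq s ->
    (\sum_(i <- s) dsum_in (x i)) j = if j \in s then x j else 0.
  apply/ffunP => j; rewrite /index_enum -enumT H ?enum_uniq //.
  by rewrite mem_enum.
elim: s => [|i s IHs] /=; first by rewrite big_nil ffunE.
case/andP=> i_s uniq_s; rewrite big_cons ffunE IHs // ffunE inE.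
case: (eqVneq j i) i_s => [-> /negPf->|ne _] /=; first by rewrite dfwith_in addr0.
by rewrite dfwith_out 1?eq_sym // add0r.
Qed.

(* Delta_{a+b} = T_b Delta_a + Delta_b, with T_b the translation by b, so that a
   condition on all Delta_a may be checked for a in a single summand. *)
Lemma dvdz_Delta_dsum (d : int) (h : dsum G -> int) :
  (forall i (a : G i) x, (d %| Delta (dsum_in a) h x)%Z) ->
  forall a x, (d %| Delta a h x)%Z.
Proof.
move=> dvd a; rewrite (dsum_inE a).
apply: (big_ind (fun a => forall x, (d %| Delta a h x)%Z)) => [x|b c Hb Hc x|i _].
- by rewrite /Delta addr0 subrr dvdz0.
- have -> : Delta (b + c) h x = Delta c h (x + b) + Delta b h x.
    by rewrite /Delta addrA subrKA.
  exact: rpredD.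
- exact: dvd.
Qed.

(** In terms of ideals: I^n is generated by the products of n factors [a] - [0] with each a in a
    single summand. *)
Lemma dvdz_Deltas_dsum (d : int) (n : nat) (g : dsum G -> int) :
  (forall s : seq {i : 'I_r & G i}, size s = n ->
     forall x, (d %| Deltas [seq dsum_in (tagged u) | u <- s] g x)%Z) ->
  forall s, size s = n -> forall x, (d %| Deltas s g x)%Z.
Proof.
elim: n g => [|n IHn] g dvd s.
  by move/size0nil->; apply: (dvd [::]).
(* The outer difference moves inside, so that induction applies to [Delta a g]; it moves out again
   once the other directions lie in summands. *)
case: s => // a s [size_s] x; rewrite /= -Deltas_Delta.
apply: IHn => // u size_u {}x; rewrite Deltas_Delta.
apply: dvdz_Delta_dsum => i b {}x; have sz : size (existT (fun i => G i) i b :: u) = n.+1 by rewrite /= size_u.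
exact: dvd sz x.
Qed.

(** Translation by an element of summand i changes only coordinate i, so the difference acts on that
    factor alone. Linking g and h by equations lets either one be a [dfwith] update of the other. *)
Lemma Delta_dsum_in_prod (i : 'I_r) (a : G i) (g h : forall j, G j -> int) :
  g i =1 Delta a (h i) -> (forall j, i != j -> g j =1 h j) ->
  forall x : dsum G,
  Delta (dsum_in a) (fun y : dsum G => \prod_j h j (y j)) x = \prod_j g j (x j).
Proof.
move=> gi gj x; rewrite /Delta !(bigD1 (P := xpredT) i) //= gi /Delta mulrBl.
congr (_ * _ - _ * _).
- by rewrite !ffunE dfwith_in.
- apply: eq_bigr => j ne; rewrite !ffunE dfwith_out 1?eq_sym // addr0.
  by rewrite gj // eq_sym.
- by apply: eq_bigr => j ne; rewrite gj // eq_sym.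
Qed.

Lemma kron_dsum (x : dsum G) : kron x = \prod_i kron (x i).
Proof.
rewrite /kron; case: eqVneq => [->|nz].
  by rewrite big1 // => i _; rewrite ffunE eqxx.
have [i xi] : exists i, x i != 0.
  apply/existsP; apply: contraNT nz => /existsPn H; apply/eqP/ffunP => i.
  by rewrite ffunE; apply/eqP/negPn.
by rewrite (bigD1 i) //= (negPf xi) mul0r.
Qed.

Lemma sum_size_dfwith (s : forall i, seq (G i)) (i : 'I_r) (t : seq (G i)) :
  (\sum_j size (dfwith s t j) + size (s i) = \sum_j size (s j) + size t)%N.
Proof.
rewrite (bigD1 i) //= [in RHS](bigD1 i) //= dfwith_in.
rewrite (eq_bigr (fun j => size (s j))) => [|j ne]; last by rewrite dfwith_out 1?eq_sym.
by rewrite addnC addnA addnAC.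
Qed.

(** Sorting the directions by summand turns the product into an elementary tensor, starting from the
    factorization of [kron]. *)
Lemma Deltas_pure_prod (u : seq {i : 'I_r & G i}) :
  exists s : forall i, seq (G i), (\sum_i size (s i))%N = size u /\
    forall x : dsum G, Deltas [seq dsum_in (tagged v) | v <- u] (@kron (dsum G)) x
      = \prod_i Deltas (s i) (@kron (G i)) (x i).
Proof.
elim: u => [|[i a] u [s [sz_s sE]]].
  exists (fun i => [::]); split; first by rewrite big1.
  exact: kron_dsum.
exists (dfwith s (a :: s i)); split.
  have := sum_size_dfwith s (a :: s i).
  by rewrite /= sz_s addnS -addSn => /addIn.
move=> x; rewrite -(@Delta_dsum_in_prod i a
    (fun j => Deltas (dfwith s (a :: s i) j) (@kron (G j)))
    (fun j => Deltas (s j) (@kron (G j)))).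
- by rewrite /= /Delta !sE.
- by rewrite dfwith_in.
- by move=> j ne; rewrite dfwith_out.
Qed.

(** Induction on the total length: the head of some nonempty [s i] becomes a direction in the direct
    sum. *)
Lemma prod_Deltas_dsum (s : forall i, seq (G i)) :
  exists u : seq (dsum G), size u = (\sum_i size (s i))%N /\
    forall x : dsum G,
      Deltas u (@kron (dsum G)) x = \prod_i Deltas (s i) (@kron (G i)) (x i).
Proof.
have [n sz_s] : exists n, (\sum_i size (s i))%N = n by eexists.
elim: n s sz_s => [|n IHn] s sz_s.
  exists [::]; split; first by rewrite sz_s.
  move=> x; rewrite /= kron_dsum; apply: eq_bigr => i _.
  move/eqP: sz_s; rewrite sum_nat_eq0 => /forallP/(_ i)/= /nilP -> //.
have [i] : exists i, (0 < size (s i))%N.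
  apply/existsP; apply: contraTT isT => /existsPn H; move/eqP: sz_s.
  by rewrite big1 // => i _; apply/eqP; rewrite -leqn0 leqNgt.
case def_s : (s i) => [//|a t] _.
have sz_t : (\sum_j size (dfwith s t j))%N = n.
  have := sum_size_dfwith s t; rewrite def_s sz_s /= addnS addSn => -[].
  exact: addIn.
have [u [sz_u uE]] := IHn _ sz_t.
exists (dsum_in a :: u); split; first by rewrite /= sz_u sz_t sz_s.
move=> x; rewrite -(@Delta_dsum_in_prod i a (fun j => Deltas (s j) (@kron (G j)))
    (fun j => Deltas (dfwith s t j) (@kron (G j)))).
- by rewrite /= /Delta !uE.
- by rewrite dfwith_in def_s.
- by move=> j ne; rewrite dfwith_out.
Qed.

Lemma aug_pow_nondvd_dsum (d : int) (m : nat) :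
  aug_pow_nondvd (dsum G) d m <->
  exists (s : forall i, seq (G i)) (x : dsum G), (\sum_i size (s i))%N = m /\
    ~~ (d %| \prod_i Deltas (s i) (@kron (G i)) (x i))%Z.
Proof.
split=> [[s [x [sz_s nd]]]|[s [x [<- nd]]]]; last first.
  by have [u [sz_u uE]] := prod_Deltas_dsum s; exists u, x; rewrite uE.
apply: NNPP => H; move/negP: nd; apply; apply: (dvdz_Deltas_dsum _ sz_s).
move=> u sz_u {}x; have [t [sz_t tE]] := Deltas_pure_prod u.
rewrite tE; apply/negPn/negP => nd; apply: H; exists t, x.
by rewrite sz_t.
Qed.

End DirectSum.

(** * Splitting m and beta - 1 among the summands *)

Lemma dep_choice (I : Type) (T : I -> Type) (P : forall i, T i -> Prop) :
  (forall i, exists x, P i x) -> exists f : forall i, T i, forall i, P i (f i).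
Proof.
move=> H; exists (fun i => proj1_sig (constructive_indefinite_description _ (H i))).
by move=> i; case: constructive_indefinite_description.
Qed.

Lemma absz_prod (r : nat) (c : 'I_r -> int) :
  absz (\prod_i c i) = (\prod_i absz (c i))%N.
Proof. by elim/big_rec2: _ => // i n z _ <-; rewrite abszM. Qed.

(** A coefficient of an elementary tensor is a product of one coefficient per factor. These can be
    chosen independently, since a point of the direct sum is any choice of coordinates. *)
Lemma aug_pow_nondvd_dsum_pfactor (p beta r m : nat) (G : 'I_r -> zmodType) :
  prime p -> (1 <= beta)%N -> (0 < r)%N ->
  aug_pow_nondvd (dsum G) (p ^ beta)%N m <->
  exists bs : 'I_r -> nat, (\sum_i bs i)%N = beta.-1 /\
    exists ms : 'I_r -> nat, (\sum_i ms i)%N = m /\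
      forall i, aug_pow_nondvd (G i) (p ^ (bs i).+1)%N (ms i).
Proof.
move=> p_pr beta_gt0 r_gt0; apply: (iff_trans (aug_pow_nondvd_dsum _ _ _)).
have dvdE (s : forall i, seq (G i)) (x : dsum G) :=
  pfactor_ndvdn_prod (fun i => absz (Deltas (s i) (@kron (G i)) (x i)))
    p_pr r_gt0 beta_gt0.
split.
  case=> s [x [<-]]; rewrite dvdzE absz_prod => /dvdE[bs [sum_bs nd]].
  exists bs; split=> //; exists (fun i => size (s i)); split=> // i.
  by exists (s i), (x i); split; last exact: nd.
case=> bs [sum_bs [ms [<- /dep_choice[s /dep_choice[x H]]]]].
exists s, [ffun i => x i]; split.
  by apply: eq_bigr => i _; case: (H i).
rewrite dvdzE absz_prod; apply/dvdE; exists bs; split=> // i.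
by rewrite ffunE; case: (H i).
Qed.

Unset Implicit Arguments.

Theorem theorem4 (p beta r : nat) (A : 'I_r -> finZmodType) (B : zmodType) :
  prime p -> (1 <= beta)%N -> (0 < r)%N ->
  (forall i, (1 < #|A i|)%N /\ p.-nat #|A i|) ->
  (forall b : B, b *+ (p ^ beta) = 0) ->
  (exists b : B, b *+ (p ^ beta.-1) != 0) ->
  delta (dsum (fun i => (A i : zmodType))) B
  = nt_sup (fun d => exists bs : 'I_r -> nat,
                (\sum_(i < r) bs i)%N = beta.-1 /\
                d = nt_sum (fun i => delta (A i) 'Z_(p ^ (bs i).+1))).
Proof.
move=> p_pr beta_gt0 r_gt0 _ expB nzB; apply: nt_eq_of_ge => m.
apply: (iff_trans (nt_ge_delta (dsum (fun i => (A i : zmodType))) m p_pr expB nzB)).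
apply: (iff_trans (aug_pow_nondvd_dsum_pfactor _ _ p_pr beta_gt0 r_gt0)).
(* On the right, m is below the supremum iff it is below one of the sums, hence iff it splits into
   m_i below the summands of that sum. *)
apply: (iff_trans _ (iff_sym (nt_ge_sup _ _))); split.
  case=> bs [sum_bs [ms [sum_ms H]]].
  exists (nt_sum (fun i => delta (A i) 'Z_(p ^ (bs i).+1))); split; first by exists bs.
  by apply/nt_ge_sum; exists ms; split=> // i; apply/nt_ge_delta_Zp.
case=> _ [[bs [sum_bs ->]] /nt_ge_sum[ms [sum_ms H]]].
exists bs; split=> //; exists ms; split=> // i.
by apply/nt_ge_delta_Zp.
Qed.
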